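(* Unique exact relative prime factorization does not imply the finite relative presentation property, even under finite relative quotient and finite relative prime spectrum. That is: there exist a finite alphabet $\Sigma$, a language $L\subseteq\Sigma^*$, and a monoid morphism $h:\Sigma^*\to M$ into a finite monoid such that the relative quotient $\Sigma^*/\theta_{L,h}$ is finite, the set $\mathcal P$ of relative primes is finite, every live non-unit relative class has a unique exact factorization into relative primes, and the set $\mathcal V$ of valid productions is infinite (so FRP fails).
   Context: For $L\subseteq\Sigma^*$ and a monoid morphism $h:\Sigma^*\to M$ into a finite monoid: $D_L(x)=\{(u,v):uxv\in L\}$; $x\equiv_L y$ iff $D_L(x)=D_L(y)$. The relative syntactic congruence $\theta_{L,h}$ is: $x\,\theta_{L,h}\,y$ iff $x\equiv_L y$ and $h(x)=h(y)$; its classes $[x]$ are called relative classes. A relative class is live if $D_L(x)\neq\varnothing$ for its members. The unit class is $[\varepsilon]$; non-unit means different from $[\varepsilon]$. For relative classes $X,Y$: $X\cdot Y=\{xy:x\in X,y\in Y\}$ (exact setwise product), $X*Y=[xy]$ for any $x\in X,y\in Y$ (quotient product). A relative prime is a live non-unit relative class $P$ such that whenever $P=X\cdot Y$ (equality of sets) for relative classes $X,Y$, one of $X,Y$ is $[\varepsilon]$; $\mathcal P$ is the set of relative primes. An exact factorization of $X$ into relative primes is a finite nonempty sequence $(P_1,\dots,P_k)$ in $\mathcal P$ with $X=P_1\cdot\ldots\cdot P_k$ as sets. For $P\in\mathcal P$ and $\alpha=P_1\cdots P_k\in\mathcal P^{k}$, $k\ge2$, the production $P\to\alpha$ is correct if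 $P_1*\cdots*P_k=P$; $\alpha$ is pleonastic if some proper contiguous block of $\alpha$ of length $\ge2$ has quotient product in $\mathcal P$; a correct production is valid if its right-hand side is not pleonastic. $\mathcal V$ is the set of valid productions. FRP (finite relative presentation property) means $|\mathcal P|<\infty$ and $|\mathcal V|<\infty$. *)

(* Defs.v *)
From HB Require Import structures.
From mathcomp Require Import all_boot.
From mathcomp Require Import all_classical.

Set Implicit Arguments.
Unset Strict Implicit.
Unset Printing Implicit Defensive.

Local Open Scope classical_set_scope.

#[short(type="finMonoidType")]
HB.structure Definition FinMonoid := {M of Monoid M & Finite M}.

Definition word (Sigma : finType) : Type := seq Sigma.

HB.instance Definition _ (Sigma : finType) :=
  Choice.copy (word Sigma) (seq Sigma).
HB.instance Definition _ (Sigma : finType) :=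
  isMonoid.Build (word Sigma) (@catA Sigma) (@cat0s Sigma) (@cats0 Sigma).

Definition contexts (Sigma : finType) (L : set (word Sigma)) (x : word Sigma) :
  set (word Sigma * word Sigma) := [set c | L (c.1 ++ x ++ c.2)].

Definition synt_equiv (Sigma : finType) (L : set (word Sigma))
  (x y : word Sigma) : Prop := contexts L x = contexts L y.

Definition theta (Sigma : finType) (M : finMonoidType) (L : set (word Sigma))
  (h : word Sigma -> M) (x y : word Sigma) : Prop :=
  synt_equiv L x y /\ h x = h y.

Definition rclass (Sigma : finType) (M : finMonoidType) (L : set (word Sigma))
  (h : word Sigma -> M) (x : word Sigma) : set (word Sigma) :=
  [set y | theta L h x y].

Definition rel_quotient (Sigma : finType) (M : finMonoidType)
  (L : set (word Sigma)) (h : word Sigma -> M) : set (set (word Sigma)) :=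
  range (rclass L h).

Definition unit_class (Sigma : finType) (M : finMonoidType)
  (L : set (word Sigma)) (h : word Sigma -> M) : set (word Sigma) :=
  rclass L h [::].

Definition live (Sigma : finType) (L : set (word Sigma))
  (X : set (word Sigma)) : Prop :=
  exists2 x, X x & contexts L x !=set0.

Definition exact_mul (Sigma : finType) (X Y : set (word Sigma)) :
  set (word Sigma) := [set x ++ y | x in X & y in Y].

Definition exact_prod (Sigma : finType) (s : seq (set (word Sigma))) :
  set (word Sigma) := foldr (@exact_mul Sigma) [set [::]] s.

(* The union of the classes [xy] for x in X and y in Y. When X and Y are
   relative classes and h is a morphism, all these classes coincide: see
   quot_mul_rclass and quot_mulE below. *)
Definition quot_mul (Sigma : finType) (M : finMonoidType) (L : set (word Sigma))
  (h : word Sigma -> M) (X Y : set (word Sigma)) : set (word Sigma) :=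
  [set w | exists x y, [/\ X x, Y y & rclass L h (x ++ y) w]].

Definition quot_prod (Sigma : finType) (M : finMonoidType)
  (L : set (word Sigma)) (h : word Sigma -> M) (s : seq (set (word Sigma))) :
  set (word Sigma) := foldr (quot_mul L h) (unit_class L h) s.

Definition rel_primes (Sigma : finType) (M : finMonoidType)
  (L : set (word Sigma)) (h : word Sigma -> M) : set (set (word Sigma)) :=
  [set P | [/\ rel_quotient L h P, live L P, P <> unit_class L h &
    forall X Y, rel_quotient L h X -> rel_quotient L h Y ->
      P = exact_mul X Y -> X = unit_class L h \/ Y = unit_class L h]].

Definition exact_factorization (Sigma : finType) (M : finMonoidType)
  (L : set (word Sigma)) (h : word Sigma -> M) (X : set (word Sigma))
  (s : seq (set (word Sigma))) : Prop :=
  [/\ s <> [::], (forall P, P \in s -> rel_primes L h P) & X = exact_prod s].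

Definition correct (Sigma : finType) (M : finMonoidType) (L : set (word Sigma))
  (h : word Sigma -> M) (P : set (word Sigma)) (alpha : seq (set (word Sigma))) :
  Prop :=
  [/\ rel_primes L h P, 2 <= size alpha,
      (forall Q, Q \in alpha -> rel_primes L h Q) & quot_prod L h alpha = P].

Definition pleonastic (Sigma : finType) (M : finMonoidType)
  (L : set (word Sigma)) (h : word Sigma -> M)
  (alpha : seq (set (word Sigma))) : Prop :=
  exists beta gamma delta : seq (set (word Sigma)),
    [/\ alpha = beta ++ gamma ++ delta, 2 <= size gamma,
        size gamma < size alpha & rel_primes L h (quot_prod L h gamma)].

Definition valid_productions (Sigma : finType) (M : finMonoidType)
  (L : set (word Sigma)) (h : word Sigma -> M) :
  set (set (word Sigma) * seq (set (word Sigma))) :=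
  [set p | correct L h p.1 p.2 /\ ~ pleonastic L h p.2].

Definition FRP (Sigma : finType) (M : finMonoidType) (L : set (word Sigma))
  (h : word Sigma -> M) : Prop :=
  finite_set (rel_primes L h) /\ finite_set (valid_productions L h).

Lemma theta_cat (Sigma : finType) (M : finMonoidType) (L : set (word Sigma))
  (h : word Sigma -> M) (hM : monoid_morphism h) (x x' y y' : word Sigma) :
  theta L h x x' -> theta L h y y' -> theta L h (x ++ y) (x' ++ y').
Proof.
move=> [Dx hx] [Dy hy]; split; last first.
  by have [_ mulh] := hM; rewrite (mulh x y) (mulh x' y') hx hy.
apply/seteqP; split=> -[u v]; rewrite /contexts /= -!catA => Luv.
- have : contexts L x (u, y ++ v) by [].
  rewrite Dx /contexts /= => Lu.
  have : contexts L y (u ++ x', v) by rewrite /contexts /= -!catA.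
  by rewrite Dy /contexts /= -!catA.
- have : contexts L x' (u, y' ++ v) by [].
  rewrite -Dx /contexts /= => Lu.
  have : contexts L y' (u ++ x, v) by rewrite /contexts /= -!catA.
  by rewrite -Dy /contexts /= -!catA.
Qed.

Lemma quot_mul_rclass (Sigma : finType) (M : finMonoidType)
  (L : set (word Sigma)) (h : word Sigma -> M) (hM : monoid_morphism h)
  (x y : word Sigma) :
  quot_mul L h (rclass L h x) (rclass L h y) = rclass L h (x ++ y).
Proof.
apply/seteqP; split=> [w [x' [y' [xx' yy' [Dw hw]]]]|w xyw].
  have [Dxy hxy] := theta_cat hM xx' yy'.
  by split; [exact: etrans Dxy Dw | rewrite hxy].
by exists x, y; split.
Qed.

Lemma quot_mulE (Sigma : finType) (M : finMonoidType)
  (L : set (word Sigma)) (h : word Sigma -> M) (hM : monoid_morphism h)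
  (X Y : set (word Sigma)) (x y : word Sigma) :
  rel_quotient L h X -> rel_quotient L h Y -> X x -> Y y ->
  quot_mul L h X Y = rclass L h (x ++ y).
Proof.
move=> [x0 _ <-] [y0 _ <-] xx yy; rewrite quot_mul_rclass //.
have [Dxy hxy] := theta_cat hM xx yy.
by apply/seteqP; split=> w [Dw hw]; split; rewrite /synt_equiv ?Dxy ?hxy // -?Dxy -?hxy.
Qed.

(* Main.v *)
From HB Require Import structures.
Require Import Defs.
From mathcomp Require Import all_boot.
From mathcomp Require Import all_classical.

Local Open Scope classical_set_scope.

(** Over the letters a, b, c, d, z, let L be the language of factors of
    c (a z^* b)^+ d and let h be the projection onto a monoid of 24 normal
    forms and a zero. The class P = [ab] = a z^* b is prime because ab can only
    be cut as {a}{b}, which misses azb, and so is T = [cabd] = c P^+ d. But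
    every power P^m with m >= 2 has the same class
    [abab] = {a} Q {b}, where Q = [ba] = (z^* b a)^+ z^* is prime: the
    exact factorization of [abab] is not aligned with the boundaries of the
    copies of P. Hence T -> c P^m d is a valid production for every m >= 2,
    since its proper blocks of length >= 2 lie in composite classes. Exactness
    of the factorizations holds because in each composite class all words share their
    first (or last) letter, and deleting it leads to a single class; uniqueness
    only requires two test words in each class. *)

(** * The alphabet, the normal forms and the table of classes *)

Inductive letter := A | B | C | D | Z.

Definition letter_code (x : letter) : nat :=
  match x with A => 0 | B => 1 | C => 2 | D => 3 | Z => 4 end.

Definition letter_decode (n : nat) : option letter :=
  nth None [:: Some A; Some B; Some C; Some D; Some Z] n.

Lemma letter_codeK : pcancel letter_code letter_decode.
Proof. by case. Qed.

HB.instance Definition _ := Countable.copy letter (pcan_type letter_codeK).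

Definition letters : seq letter := [:: A; B; C; D; Z].

Lemma letters_enum : Finite.axiom letters.
Proof. by case. Qed.

HB.instance Definition _ := isFinite.Build letter letters_enum.

Lemma mem_letters (x : letter) : x \in letters.
Proof. by case: x. Qed.

(** The zero is represented by a word of its own class, so that [nf] fixes it like every other
    normal form. *)
Definition dead : seq letter := [:: C; C].

(* The normal form of [x :: w] for a normal form [w]. The nonzero words are
   those with all adjacent pairs among ca, ab, az, zz, zb, ba, bd; the relations
   are zz = z, azb = ab, zba = baz = baba = ba and cababd = cabd. *)
Definition step (x : letter) (w : seq letter) : seq letter :=
  match x, w with
  | _, [::] => [:: x]
  | Z, Z :: _ | Z, B :: A :: _ => w
  | A, Z :: B :: r => A :: B :: r
  | B, A :: Z :: _ => [:: B; A]
  | B, A :: B :: A :: r => B :: A :: r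
  | C, [:: A; B; A; B; D] => [:: C; A; B; D]
  | C, A :: _ | A, B :: _ | A, Z :: _ | Z, B :: _ | B, A :: _ | B, D :: _ =>
      x :: w
  | _, _ => dead
  end.

Definition nf_cat (u v : seq letter) : seq letter := foldr step v u.

Definition nf (w : seq letter) : seq letter := nf_cat w [::].

(* A row [(m, t, e)] records a normal form [m], the factorization [t] of its
   class into primes, and a word [e] of that class chosen so that [t] is the only
   prime factorization compatible with both [m] and [e]. *)
Definition class_table : seq (seq letter * seq (seq letter) * seq letter) :=
  [:: ([:: A], [:: [:: A]], [:: A]);
      ([:: B], [:: [:: B]], [:: B]);
      ([:: C], [:: [:: C]], [:: C]);
      ([:: D], [:: [:: D]], [:: D]);
      ([:: Z], [:: [:: Z]], [:: Z]);
      ([:: A; B], [:: [:: A; B]], [:: A; Z; B]);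
      ([:: B; A], [:: [:: B; A]], [:: B; A; B; A]);
      ([:: C; A; B; D], [:: [:: C; A; B; D]], [:: C; A; B; A; B; D]);
      ([:: C; A], [:: [:: C]; [:: A]], [:: C; A]);
      ([:: A; Z], [:: [:: A]; [:: Z]], [:: A; Z]);
      ([:: Z; B], [:: [:: Z]; [:: B]], [:: Z; B]);
      ([:: B; D], [:: [:: B]; [:: D]], [:: B; D]);
      ([:: C; A; Z], [:: [:: C]; [:: A]; [:: Z]], [:: C; A; Z]);
      ([:: Z; B; D], [:: [:: Z]; [:: B]; [:: D]], [:: Z; B; D]);
      ([:: C; A; B], [:: [:: C]; [:: A; B]], [:: C; A; Z; B]);
      ([:: A; B; D], [:: [:: A; B]; [:: D]], [:: A; Z; B; D]);
      ([:: A; B; A], [:: [:: A]; [:: B; A]], [:: A; Z; B; A; B; A]);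
      ([:: B; A; B], [:: [:: B; A]; [:: B]], [:: B; A; B; A; Z; B]);
      ([:: C; A; B; A], [:: [:: C]; [:: A]; [:: B; A]],
       [:: C; A; Z; B; A; B; A]);
      ([:: B; A; B; D], [:: [:: B; A]; [:: B]; [:: D]],
       [:: B; A; B; A; Z; B; D]);
      ([:: A; B; A; B], [:: [:: A]; [:: B; A]; [:: B]],
       [:: A; Z; B; A; B; A; Z; B]);
      ([:: C; A; B; A; B], [:: [:: C]; [:: A]; [:: B; A]; [:: B]],
       [:: C; A; Z; B; A; B; A; Z; B]);
      ([:: A; B; A; B; D], [:: [:: A]; [:: B; A]; [:: B]; [:: D]],
       [:: A; Z; B; A; B; A; Z; B; D])].

Definition normal_forms : seq (seq letter) :=
  [::] :: dead :: [seq r.1.1 | r <- class_table].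

(** The words [[::]] and [dead] have no row; the default gives them the empty factorization, so
    neither satisfies [prime_nf]. *)
Definition class_row (m : seq letter) :=
  nth ([::], [::], [::]) class_table (find (fun r => r.1.1 == m) class_table).

Definition fact (m : seq letter) : seq (seq letter) := (class_row m).1.2.

Definition extra (m : seq letter) : seq letter := (class_row m).2.

Definition prime_nf (m : seq letter) : bool :=
  (m \in normal_forms) && (fact m == [:: m]).

(** * Compatibility of normal forms with concatenation *)

Lemma step_normal (x : letter) (m : seq letter) :
  m \in normal_forms -> step x m \in normal_forms.
Proof.
have /allP/(_ x (mem_letters x))/allP : all (fun y => all (fun n =>
  step y n \in normal_forms) normal_forms) letters by vm_compute.
exact.
Qed.

(** The finite check behind associativity: letters act on normal forms from the left, and reducing a
    prefix does not change its action. *)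
Lemma nf_cat_step (x : letter) (m p : seq letter) :
  m \in normal_forms -> p \in normal_forms ->
  nf_cat (step x m) p = step x (nf_cat m p).
Proof.
move=> mN pN.
have /allP/(_ x (mem_letters x))/allP/(_ m mN)/allP/(_ p pN)/eqP // :
  all (fun y => all (fun n => all (fun q =>
  nf_cat (step y n) q == step y (nf_cat n q)) normal_forms) normal_forms)
  letters by vm_compute.
Qed.

Lemma nf_id (m : seq letter) : m \in normal_forms -> nf m = m.
Proof.
move=> mN; have /allP/(_ m mN)/eqP // : all (fun n => nf n == n) normal_forms
  by vm_compute.
Qed.

Lemma nf_cat_normal (u p : seq letter) :
  p \in normal_forms -> nf_cat u p \in normal_forms.
Proof. by move=> pN; elim: u => //= x u IHu; exact: step_normal. Qed.

Lemma nf_normal (w : seq letter) : nf w \in normal_forms.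
Proof. exact: nf_cat_normal. Qed.

Lemma nf_catE (u p : seq letter) :
  p \in normal_forms -> nf_cat (nf u) p = nf_cat u p.
Proof.
move=> pN; elim: u => //= x u IHu.
by rewrite [nf _]/= nf_cat_step ?nf_normal // IHu.
Qed.

Lemma nf_cat_nf (u v : seq letter) : nf (u ++ v) = nf_cat u (nf v).
Proof. by rewrite /nf /nf_cat foldr_cat. Qed.

Lemma nf_cat_nfl (u v : seq letter) : nf (u ++ v) = nf_cat (nf u) (nf v).
Proof. by rewrite nf_catE ?nf_normal // nf_cat_nf. Qed.

Lemma nf_cat_congr (u u' v v' : seq letter) :
  nf u = nf u' -> nf v = nf v' -> nf (u ++ v) = nf (u' ++ v').
Proof. by move=> uu' vv'; rewrite !nf_cat_nfl uu' vv'. Qed.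

Lemma nf_flatten (ps : seq (seq letter)) :
  nf (flatten ps) = nf (flatten (map nf ps)).
Proof.
by elim: ps => //= p ps IHps; apply: nf_cat_congr;
  rewrite ?(nf_id _ (nf_normal p)).
Qed.

Lemma nf_cat_dead (u v : seq letter) :
  (nf u == dead) || (nf v == dead) -> nf (u ++ v) = dead.
Proof.
have dead_absorb : all (fun n => (nf_cat dead n == dead) &&
  (nf_cat n dead == dead)) normal_forms by vm_compute.
rewrite nf_cat_nfl => /orP[]/eqP->.
- by have /allP/(_ _ (nf_normal v))/andP[/eqP] := dead_absorb.
- by have /allP/(_ _ (nf_normal u))/andP[_ /eqP] := dead_absorb.
Qed.

(** * The finite monoid of normal forms *)

Definition nform : Type := seq_sub normal_forms.

HB.instance Definition _ := Finite.copy nform (seq_sub normal_forms).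

Lemma nform_inj (m n : nform) : ssval m = ssval n -> m = n.
Proof. exact: (@val_inj _ _ (seq_sub normal_forms)). Qed.

Definition to_nform (w : seq letter) : nform := SeqSub (nf_normal w).

Lemma val_to_nform (m : nform) : to_nform (ssval m) = m.
Proof. exact/nform_inj/nf_id/ssvalP. Qed.

Definition nform_mul (m n : nform) : nform := to_nform (ssval m ++ ssval n).

Lemma to_nform_cat (u v : seq letter) :
  to_nform (u ++ v) = nform_mul (to_nform u) (to_nform v).
Proof.
by apply/nform_inj/nf_cat_congr; apply/esym/nf_id/nf_normal.
Qed.

(** Every element is the normal form of a word, so the law is inherited from concatenation. *)
Lemma nform_mulA : associative nform_mul.
Proof.
move=> m n p; rewrite -[m]val_to_nform -[n]val_to_nform -[p]val_to_nform.
by rewrite -!to_nform_cat catA.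
Qed.

Lemma nform_mul1n : left_id (to_nform [::]) nform_mul.
Proof. by move=> m; rewrite -[m]val_to_nform -to_nform_cat. Qed.

Lemma nform_muln1 : right_id (to_nform [::]) nform_mul.
Proof. by move=> m; rewrite -[m]val_to_nform -to_nform_cat cats0. Qed.

HB.instance Definition _ :=
  isMonoid.Build nform nform_mulA nform_mul1n nform_muln1.

Definition morph_nf : word letter -> nform := to_nform.

Lemma morph_nf_morphism : monoid_morphism morph_nf.
Proof. by split=> // u v; exact: to_nform_cat. Qed.

(** * The language and its relative classes *)

Definition lang : set (word letter) := [set w | nf w != dead].

Definition fiber (m : seq letter) : set (word letter) := [set w | nf w = m].

(** The morphism separates normal forms; equal normal forms give equal contexts, since [nf] is a
    congruence and membership in [lang] depends on [nf] alone. *)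
Lemma rclass_nf (w : word letter) : rclass lang morph_nf w = fiber (nf w).
Proof.
apply/seteqP; split=> [v [_ /(congr1 (@ssval _ _))]|v nfv]; first exact: esym.
split; last by apply: nform_inj; rewrite /= nfv.
by apply/seteqP; split=> -[x y]; rewrite /contexts /lang /=;
  rewrite (nf_cat_congr x x (w ++ y) (v ++ y)) //; exact: nf_cat_congr.
Qed.

Lemma fiber_rclass (m : seq letter) :
  m \in normal_forms -> fiber m = rclass lang morph_nf m.
Proof. by move=> mN; rewrite rclass_nf nf_id. Qed.

Lemma fiber_rel_quotient (m : seq letter) :
  m \in normal_forms -> rel_quotient lang morph_nf (fiber m).
Proof. by move=> mN; exists m => //; rewrite fiber_rclass. Qed.

Lemma rel_quotient_fiber (X : set (word letter)) :
  rel_quotient lang morph_nf X -> exists2 m, m \in normal_forms & X = fiber m.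
Proof. by move=> [w _ <-]; exists (nf w); rewrite ?nf_normal ?rclass_nf. Qed.

Lemma unit_class_fiber : unit_class lang morph_nf = fiber [::].
Proof. exact: rclass_nf. Qed.

Lemma fiber_inj (m n : seq letter) :
  m \in normal_forms -> fiber m = fiber n -> m = n.
Proof.
move=> mN mn; have : fiber m m by exact: nf_id.
by rewrite mn => <-; rewrite nf_id.
Qed.

Lemma live_fiber (m : seq letter) :
  m \in normal_forms -> live lang (fiber m) <-> m != dead.
Proof.
move=> mN; split=> [[w <- [[x y]]]|m_live].
  by rewrite /contexts /lang /=; apply: contra => w_dead;
    rewrite (nf_cat_dead x) // (nf_cat_dead w) ?w_dead ?orbT.
exists m; first exact: nf_id.
by exists ([::], [::]); rewrite /contexts /lang /= cats0 nf_id.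
Qed.

(** * Existence of exact factorizations *)

Lemma exact_prod_fiber (t : seq (seq letter)) (w : word letter) :
  exact_prod (map fiber t) w <-> exists2 ps, w = flatten ps & map nf ps = t.
Proof.
elim: t w => [|m t IHt] w /=; split.
- by move=> ->; exists [::].
- by move=> [[|//] ->].
- by move=> [u um [v /IHt[ps -> pst] <-]]; exists (u :: ps) => //=;
    rewrite pst um.
- move=> [[//|p ps] -> [pm pst]]; exists p => //; exists (flatten ps) => //.
  by apply/IHt; exists ps.
Qed.

(** Induction on length: in a live class that is neither the unit nor prime, all words share an end
    letter, and removing it leaves the rest of the factorization. *)
Lemma fact_split (w : seq letter) : nf w != dead ->
  exists2 ps, w = flatten ps & map nf ps = fact (nf w).
Proof.
(* Whenever prefixing [y] to class [n] gives [m], the first factor of [m] is [y] and the others are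
   those of [n]. *)
pose left_strip m := all (fun y => all (fun n =>
  (step y n == m) ==> (fact m == [:: y] :: fact n)) normal_forms) letters.
pose right_strip m := all (fun y => all (fun n =>
  (nf_cat n [:: y] == m) ==> (fact m == rcons (fact n) [:: y]))
  normal_forms) letters.
have strips : all (fun m => [|| m == dead, m == [::], fact m == [:: m],
  left_strip m | right_strip m]) normal_forms by vm_compute.
have [n] := ubnP (size w); elim: n w => // n IHn w lt_wn w_live.
have /allP/(_ _ (nf_normal w)) := strips; rewrite (negPf w_live) /=.
case/or4P=> [/eqP w1|/eqP fw|left_w|right_w].
- case: w w1 {lt_wn w_live} => [|x w] w1; first by exists [::].
  have /allP/(_ x (mem_letters x))/allP/(_ _ (nf_normal w)) : all (fun y =>
    all (fun n => step y n != [::]) normal_forms) letters by vm_compute.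
  by rewrite -w1 eqxx.
- by exists [:: w]; rewrite /= ?cats0 ?fw.
- case: w lt_wn w_live left_w => [|x w] lt_wn w_live left_w.
    by exists [::].
  have /allP/(_ x (mem_letters x))/allP/(_ _ (nf_normal w)) := left_w.
  rewrite eqxx /= => /eqP ->.
  have [//||ps -> psE] := IHn w.
    by apply: contra w_live => wd; rewrite -cat1s nf_cat_dead // wd orbT.
  by exists ([:: x] :: ps) => //=; rewrite psE; case: (x).
- case/lastP: w lt_wn w_live right_w => [|w x] lt_wn w_live right_w.
    by exists [::].
  have /allP/(_ x (mem_letters x))/allP/(_ _ (nf_normal w)) := right_w.
  rewrite -cats1 nf_cat_nfl (_ : nf [:: x] = [:: x]); last by case: (x).
  rewrite eqxx /= => /eqP ->.
  have [||ps wE psE] := IHn w; first by rewrite size_rcons in lt_wn.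
    by apply: contra w_live => wd; rewrite -cats1 nf_cat_dead // wd.
  exists (rcons ps [:: x]); first by rewrite flatten_rcons -wE.
  by rewrite map_rcons psE; case: (x).
Qed.

Lemma flatten_fact (m : seq letter) :
  m \in normal_forms -> m != dead -> nf (flatten (fact m)) = m.
Proof.
move=> mN m_live; have /allP/(_ m mN) : all (fun n =>
  (n == dead) || (nf (flatten (fact n)) == n)) normal_forms by vm_compute.
by rewrite (negPf m_live) => /eqP.
Qed.

Lemma fiber_fact (m : seq letter) :
  m \in normal_forms -> m != dead -> fiber m = exact_prod (map fiber (fact m)).
Proof.
move=> mN m_live; apply/seteqP; split=> w.
- by move=> wm; apply/exact_prod_fiber; rewrite -wm; apply: fact_split;
    rewrite wm.
- move=> /exact_prod_fiber[ps -> psE].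
  by rewrite /fiber /= nf_flatten psE flatten_fact.
Qed.

Lemma extra_fiber (m : seq letter) :
  m \in normal_forms -> m != dead -> nf (extra m) = m.
Proof.
move=> mN m_live; have /allP/(_ m mN) : all (fun n =>
  (n == dead) || (nf (extra n) == n)) normal_forms by vm_compute.
by rewrite (negPf m_live) => /eqP.
Qed.

(** * Relative primes are the fibers of prime normal forms *)

Lemma prime_nf_live (m : seq letter) : prime_nf m -> (m != dead) && (m != [::]).
Proof.
move=> /andP[mN pm]; have /allP/(_ m mN) : all (fun n =>
  (fact n == [:: n]) ==> (n != dead) && (n != [::])) normal_forms by vm_compute.
by rewrite pm.
Qed.

(** An exact product cuts both [m] and [extra m] into a prefix and a suffix of the same two classes;
    for prime rows one of these is always the unit. *)
Lemma prime_nf_rel_prime (m : seq letter) :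
  prime_nf m -> rel_primes lang morph_nf (fiber m).
Proof.
move=> pm; have /andP[m_live m1] := prime_nf_live m pm.
have mN : m \in normal_forms by case/andP: pm.
split; [exact: fiber_rel_quotient|exact/live_fiber| |].
  by rewrite unit_class_fiber => /(fiber_inj _ _ mN)/eqP; apply/negP.
move=> _ _ /rel_quotient_fiber[x xN ->] /rel_quotient_fiber[y yN ->] mE.
rewrite unit_class_fiber.
have [u ux [v vy uvE]] : exact_mul (fiber x) (fiber y) m.
  by rewrite -mE; exact: nf_id.
have [u' u'x [v' v'y u'v'E]] : exact_mul (fiber x) (fiber y) (extra m).
  by rewrite -mE; exact: extra_fiber.
(* All pairs of cut positions are tried, both ends included, hence the successors of the sizes. *)
have /allP/(_ m mN) : all (fun n => (fact n == [:: n]) ==>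
  all (fun i => all (fun j =>
    [&& nf (take i n) == nf (take j (extra n)) &
        nf (drop i n) == nf (drop j (extra n))] ==>
    (nf (take i n) == [::]) || (nf (drop i n) == [::]))
    (iota 0 (size (extra n)).+1)) (iota 0 (size n).+1)) normal_forms.
  by vm_compute.
have -> : fact m == [:: m] by case/andP: pm.
move=> /allP/(_ (size u)); rewrite mem_iota add0n ltnS leq0n.
rewrite -{1}uvE size_cat leq_addr.
move=> /(_ isT)/allP/(_ (size u')).
rewrite mem_iota add0n ltnS leq0n -{1}u'v'E size_cat leq_addr => /(_ isT).
rewrite -uvE in u'v'E *; rewrite -u'v'E !take_size_cat // !drop_size_cat //.
rewrite ux vy u'x v'y !eqxx /= => /orP[]/eqP->; by [left|right].
Qed.

Lemma rel_prime_prime_nf (m : seq letter) :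
  m \in normal_forms -> rel_primes lang morph_nf (fiber m) -> prime_nf m.
Proof.
move=> mN [_ /(live_fiber _ mN) m_live m1 m_prime]; rewrite /prime_nf mN /=.
have {}m1 : m != [::].
  by apply/eqP => mE; apply: m1; rewrite unit_class_fiber mE.
apply/idPn => pm.
(* The tail of [fact m] is the factorization of its own class, so its exact product is a single
   relative class. *)
have /allP/(_ m mN) : all (fun n => [|| n == dead, n == [::], fact n == [:: n] |
  let p := head [::] (fact n) in let n' := nf (flatten (behead (fact n))) in
  [&& p != [::], n' != [::], p \in normal_forms, n' != dead &
      fact n == p :: fact n']]) normal_forms by vm_compute.
rewrite (negPf m_live) (negPf m1) (negPf pm) /=; move: (head _ _) (behead _).
move=> p s /and5P[p1 s1 pN s_live /eqP mE].
have := m_prime (fiber p) (fiber (nf (flatten s))) (fiber_rel_quotient _ pN)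
  (fiber_rel_quotient _ (nf_normal _)).
rewrite (fiber_fact _ (nf_normal _) s_live) (fiber_fact _ mN m_live) mE.
move=> /(_ erefl); rewrite -fiber_fact ?nf_normal // unit_class_fiber.
by case=> [/(fiber_inj _ _ pN)|/(fiber_inj _ _ (nf_normal _))]/eqP; apply/negP.
Qed.

Lemma rel_primes_fiber (s : seq (set (word letter))) :
  (forall P, P \in s -> rel_primes lang morph_nf P) ->
  exists2 t, s = map fiber t & all prime_nf t.
Proof.
elim: s => [|P s IHs] sP; first by exists [::].
have [|t -> tP] := IHs; first by move=> Q Qs; apply: sP; rewrite inE Qs orbT.
have PP : rel_primes lang morph_nf P by apply: sP; rewrite inE eqxx.
have [/rel_quotient_fiber[m mN PE] _ _ _] := PP; rewrite {}PE in PP *.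
by exists (m :: t) => //=; rewrite rel_prime_prime_nf.
Qed.

(** * Uniqueness, by listing all cuts of a word into nonempty blocks *)

Fixpoint compositions (T : Type) (w : seq T) : seq (seq (seq T)) :=
  if w is x :: w' then
    flatten [seq if ps is p :: ps' then [:: [:: x] :: ps; (x :: p) :: ps']
                 else [:: [:: [:: x]]] | ps <- compositions T w']
  else [:: [::]].

Lemma mem_compositions (T : eqType) (ps : seq (seq T)) :
  [::] \notin ps -> ps \in compositions T (flatten ps).
Proof.
elim: ps => // p ps IHps; rewrite inE negb_or => /andP[p1 /IHps {}IHps].
case: p p1 => // x p _; elim: p x => [|y p IHp] x.
  apply/flattenP; exists (if ps is p :: ps' then
    [:: [:: x] :: ps; (x :: p) :: ps'] else [:: [:: [:: x]]]).
    by apply/mapP; exists ps.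
  by case: (ps) => *; rewrite inE eqxx.
apply/flattenP; exists [:: [:: x] :: (y :: p) :: ps; (x :: y :: p) :: ps].
  by apply/mapP; exists ((y :: p) :: ps).
by rewrite !inE eqxx orbT.
Qed.

Definition nf_compositions (w : seq letter) : seq (seq (seq letter)) :=
  [seq map nf ps | ps <- compositions letter w].

Lemma mem_nf_compositions (t : seq (seq letter)) (w : word letter) :
  all prime_nf t -> exact_prod (map fiber t) w -> t \in nf_compositions w.
Proof.
move=> tP /exact_prod_fiber[ps -> psE]; apply/mapP; exists ps => //.
(* An empty block would have the empty normal form, which is not prime. *)
apply: mem_compositions; apply/negP => /(map_f nf); rewrite psE.
by move=> /(allP tP)/prime_nf_live/andP[_]; rewrite eqxx.
Qed.

(** Since [m] and [extra m] both lie in the class, [t] comes from a cut of each of them; the finite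
    check leaves only [fact m]. *)
Lemma fact_unique (m : seq letter) (t : seq (seq letter)) :
  m \in normal_forms -> m != dead -> m != [::] -> all prime_nf t ->
  fiber m = exact_prod (map fiber t) -> fact m = t.
Proof.
move=> mN m_live m1 tP mE.
have /allP/(_ m mN) : all (fun n => [|| n == dead, n == [::] |
  all (fun s => (all prime_nf s) && (s \in nf_compositions (extra n)) ==>
    (fact n == s)) (nf_compositions n)]) normal_forms by vm_compute.
rewrite (negPf m_live) (negPf m1) /= => /allP/(_ t).
rewrite tP !mem_nf_compositions -?mE //; last exact: nf_id.
  by move=> /(_ isT)/eqP.
exact: extra_fiber.
Qed.

Lemma fact_prime (m : seq letter) : m \in normal_forms -> all prime_nf (fact m).
Proof.
move=> mN; have /allP/(_ m mN) // : all (fun n => all prime_nf (fact n))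
  normal_forms by vm_compute.
Qed.

Lemma unique_exact_factorization (X : set (word letter)) :
  rel_quotient lang morph_nf X -> live lang X ->
  X <> unit_class lang morph_nf ->
  exists! s, exact_factorization lang morph_nf X s.
Proof.
move=> /rel_quotient_fiber[m mN ->] /(live_fiber _ mN) m_live.
rewrite unit_class_fiber => m1.
have {}m1 : m != [::] by apply/eqP => mE; apply: m1; rewrite mE.
exists (map fiber (fact m)); split.
  split; last exact: fiber_fact.
    by move=> /(congr1 size); rewrite size_map => /size0nil fm;
      have := flatten_fact m mN m_live; rewrite fm => /esym/eqP; apply/negP.
  move=> _ /mapP[p p_fact ->]; apply: prime_nf_rel_prime.
  exact: (allP (fact_prime m mN)).
move=> s [_ /rel_primes_fiber[t -> tP] mE].
by rewrite (fact_unique m t).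
Qed.

(** * Infinitely many valid productions *)

Lemma quot_prod_fiber (t : seq (seq letter)) :
  {subset t <= normal_forms} ->
  quot_prod lang morph_nf (map fiber t) = fiber (nf (flatten t)).
Proof.
elim: t => [|m t IHt] tN; first exact: unit_class_fiber.
have mN : m \in normal_forms by apply: tN; rewrite inE eqxx.
rewrite /quot_prod /= -/(quot_prod _ _ _) IHt; last first.
  by move=> p pt; apply: tN; rewrite inE pt orbT.
rewrite -rclass_nf fiber_rclass // quot_mul_rclass ?rclass_nf //.
exact: morph_nf_morphism.
Qed.

(** Starting from two copies makes the middle reduce to [abab] for every [n]. *)
Definition long_rhs (n : nat) : seq (seq letter) :=
  [:: C] :: rcons (nseq n.+2 [:: A; B]) [:: D].

Lemma nf_nseq_AB (n : nat) :
  nf (flatten (nseq n.+2 [:: A; B])) = [:: A; B; A; B].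
Proof.
elim: n => // n IHn; rewrite [nseq _ _]/= -[flatten (_ :: _)]/([:: A; B] ++ _).
by rewrite nf_cat_nf IHn.
Qed.

Lemma all_prime_long_rhs (n : nat) : all prime_nf (long_rhs n).
Proof. by rewrite /= all_rcons all_nseq /= orbT. Qed.

(** With $P=[ab]$, a proper block of length at least 2 is $cP^k$ or $P^kd$ with $k\ge1$, or $P^k$
    with $k\ge2$. It reduces to [cab], [cabab], [abd], [ababd] or [abab], none of them prime. *)
Lemma long_rhs_block (n : nat) (u g v : seq (seq letter)) :
  long_rhs n = u ++ g ++ v -> 1 < size g -> size g < size (long_rhs n) ->
  ~~ prime_nf (nf (flatten g)).
Proof.
rewrite /long_rhs; set t := nseq n.+2 _.
have AB_block s1 s s2 : t = s1 ++ s ++ s2 -> s = nseq (size s) [:: A; B].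
  move=> /(congr1 (all (pred1 [:: A; B]))); rewrite all_pred1_nseq !all_cat.
  by move=> /esym/and3P[_ /all_pred1P].
move: t AB_block => t AB_block.
case: u => [|u0 u] /=.
  case: g => [|c g] //= [<-]; case/lastP: v => [|v d].
    (* Here the block is the whole right-hand side, against properness. *)
    by rewrite cats0 => <-; rewrite ltnn.
  rewrite -rcons_cat => /rcons_inj[/(AB_block [::])-> _].
  rewrite -cat1s nf_cat_nf size_nseq.
  by case: (size g) => [|[|k]] // _; rewrite ?nf_nseq_AB; vm_compute.
case=> _; case/lastP: v => [|v d].
  rewrite cats0; case/lastP: g => [|g d] //.
  rewrite -rcons_cat => /rcons_inj[tE <-].
  rewrite (AB_block u g [::]) ?cats0 // size_rcons size_nseq.
  rewrite flatten_rcons nf_cat_nfl.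
  by case: (size g) => [|[|k]] // _; rewrite ?nf_nseq_AB; vm_compute.
rewrite -!rcons_cat => /rcons_inj[/AB_block-> _].
rewrite size_nseq.
by case: (size g) => [|[|k]] // _; rewrite nf_nseq_AB; vm_compute.
Qed.

Lemma valid_long_rhs (n : nat) :
  valid_productions lang morph_nf
    (fiber [:: C; A; B; D], map fiber (long_rhs n)).
Proof.
have tN : {subset long_rhs n <= normal_forms}.
  by move=> m /(allP (all_prime_long_rhs n))/andP[].
split=> /=.
  split=> //=.
  - exact: prime_nf_rel_prime.
  - move=> _ /(mapP (s := long_rhs n))[m mt ->]; apply: prime_nf_rel_prime.
    exact: (allP (all_prime_long_rhs n)).
  - apply: etrans (quot_prod_fiber _ tN) _; congr fiber.
    rewrite (_ : flatten _ = [:: C] ++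
      flatten (rcons (nseq n.+2 [:: A; B]) [:: D])) // nf_cat_nf.
    by rewrite flatten_rcons nf_cat_nfl nf_nseq_AB.
move=> [u [g [v [ugvE g2 g_proper g_prime]]]].
(* The given blocks consist of classes; cutting [long_rhs n] at the same positions lifts them to
   normal forms. *)
have tE : long_rhs n = take (size u) (long_rhs n) ++
    take (size g) (drop (size u) (long_rhs n)) ++
    drop (size g) (drop (size u) (long_rhs n)) by rewrite !cat_take_drop.
set g' := take (size g) _ in tE.
have gE : g = map fiber g'.
  by rewrite /g' map_take map_drop [map _ _]ugvE drop_size_cat // take_size_cat.
rewrite {}gE in g2 g_proper g_prime.
move: g_prime; rewrite quot_prod_fiber.
  move=> /(rel_prime_prime_nf _ (nf_normal _)).
  apply/negP; apply: long_rhs_block tE _ _.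
    by rewrite size_map in g2.
  by move: g_proper; rewrite size_map /= size_map.
by move=> m /mem_take/mem_drop/tN.
Qed.

Theorem corollary12p3 :
  exists (Sigma : finType) (L : set (word Sigma))
         (M : finMonoidType) (h : word Sigma -> M),
    [/\ monoid_morphism h,
        finite_set (rel_quotient L h),
        finite_set (rel_primes L h),
        (forall X : set (word Sigma),
            rel_quotient L h X -> live L X -> X <> unit_class L h ->
            exists! s : seq (set (word Sigma)), exact_factorization L h X s) &
        infinite_set (valid_productions L h)]
    /\ ~ FRP L h.
Proof.
have quot_fin : finite_set (rel_quotient lang morph_nf).
  apply: (@sub_finite_set _ _ (fiber @` [set` normal_forms])).
    by move=> _ /rel_quotient_fiber[m mN ->]; exists m.
  exact/finite_image/finite_seq.
have valid_inf : infinite_set (valid_productions lang morph_nf).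
  move=> valid_fin; apply: infinite_nat.
  apply: (@sub_finite_set _ _ ((fun n => (fiber [:: C; A; B; D],
    map fiber (long_rhs n))) @^-1` valid_productions lang morph_nf)).
    by move=> n _; exact: valid_long_rhs.
  (* Distinct indices give right-hand sides of distinct lengths, so the map is injective. *)
  apply: finite_preimage => // m n _ _ [] /(congr1 size).
  by rewrite !size_map !size_rcons !size_nseq => -[].
exists letter, lang, nform, morph_nf; split; last by case.
split=> //; first exact: morph_nf_morphism.
- by apply: sub_finite_set quot_fin => X [].
- exact: unique_exact_factorization.
Qed.
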